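(* Let $D$ be an arbitrary complex $n \times n$ matrix, $n \ge 2$, and let $U$ be a random matrix uniformly distributed (Haar measure) over the unitary group $U(n)$. Then $$\mathbb{P}\big(s_n(D+U) \le t\big) \le t^c n^C \qquad \text{for all } t > 0,$$ where $c, C > 0$ are absolute constants.
   Context: $s_n(M) = \min_{x \in \mathbb{C}^n, \|x\|_2 = 1}\|Mx\|_2$ denotes the smallest singular value of an $n\times n$ matrix $M$. *)

(* Defs.v *)
From HB Require Import structures.
From mathcomp Require Import all_boot all_order all_algebra.
From mathcomp Require Import spectral.
From mathcomp Require Import complex.
From mathcomp Require Import all_classical all_reals all_analysis.
Set Implicit Arguments. Unset Strict Implicit. Unset Printing Implicit Defensive.
Import Order.TTheory GRing.Theory Num.Theory.
Local Open Scope classical_set_scope.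
Local Open Scope ring_scope.

Definition cmx (R : realType) (n : nat) := 'M[R[i]]_n.
HB.instance Definition _ (R : realType) n := Choice.on (cmx R n).
HB.instance Definition _ (R : realType) n := isPointed.Build (cmx R n) 0.


(* Borel sigma-algebra on C^{n x n} = R^{2 n^2}: generated by the real and
   imaginary parts of the entries (product of Borel sigma-algebras). *)
Definition cmx_generators (R : realType) (n : nat) : set (set (cmx R n)) :=
  [set A | exists (i j : 'I_n) (B : set R), measurable B /\
     (A = (fun M : cmx R n => complex.Re (M i j)) @^-1` B \/
      A = (fun M : cmx R n => complex.Im (M i j)) @^-1` B)].

Notation cmxM R n := (g_sigma_algebraType (@cmx_generators R n)).

Definition vnorm2 (R : realType) (n : nat) (x : 'cV[R[i]]_n) : R :=
  Num.sqrt (\sum_(i < n) (ComplexField.Normc.normc (x i ord0)) ^+ 2).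

(* s_n(M) = min_{||x||_2 = 1} ||M x||_2 (the infimum is attained) *)
Definition smallest_sv (R : realType) (n : nat) (M : 'M[R[i]]_n) : R :=
  inf [set vnorm2 (M *m x) | x in [set x : 'cV[R[i]]_n | vnorm2 x = 1]].

(* Haar (uniform) probability measure on the unitary group U(n), seen as a
   probability measure on the space of complex n x n matrices: it is
   concentrated on U(n) and invariant under left multiplication by unitary
   matrices (this characterizes the Haar measure uniquely). *)
Definition is_haar_unitary (R : realType) (n : nat)
    (P : probability (cmxM R n) R) : Prop :=
  P [set U : cmxM R n | U \is unitarymx] = 1%E /\
  forall (V : 'M[R[i]]_n), V \is unitarymx ->
  forall A : set (cmxM R n), measurable A ->
    P [set U : cmxM R n | V *m U \in A] = P A.

(* Main.v *)
Require Import Defs.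
From HB Require Import structures.
From mathcomp Require Import all_boot all_order all_algebra.
From mathcomp Require Import spectral complex.
From mathcomp Require Import all_classical all_reals all_analysis.
From mathcomp Require Import measurable_realfun ring lra.
Set Implicit Arguments. Unset Strict Implicit. Unset Printing Implicit Defensive.
Import Order.TTheory GRing.Theory Num.Theory.
Import numFieldNormedType.Exports.
Local Open Scope classical_set_scope.
Local Open Scope ring_scope.

(** Put [f(U) = det (D + U)] and [A(U) = U adj(D + U)].  For [|z| = 1] and a
    vector [v], the unitary [V_z = 1 + (z - 1) v v^* / |v|^2] satisfies
    [f(V_z U) = f(U) + (z - 1) q] with [q = v^* A(U) v / |v|^2], while
    [v^* A(V_z U) v = z v^* A(U) v] keeps its modulus.  Hence, for any fixed
    [U], the event [0 < |f| <= kappa |v^* A v|] holds at [V_z U] only for [z] in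
    a set of diameter [2 kappa |v|^2]; averaging over [z] on the circle, it has
    Haar probability [O(kappa |v|^2)].
    If [s_n(D + U) <= t] and [U] is unitary, then [|f| <= 2 t n^2 |A_ij|] for
    some entry of [A], and polarization bounds [|A_ij|] by [|v^* A v|] for one
    of the [4 n^2] vectors [v = e_i + w e_j], [w^4 = 1].  As [f(U) <> 0] almost
    surely (rotate [U] by scalars), a union bound gives [64 n^4 t]. *)

Local Notation normc := ComplexField.Normc.normc.
Local Notation normcM := ComplexField.Normc.normcM.
Local Notation normc0 := ComplexField.Normc.normc0.
Local Notation eq0_normc := ComplexField.Normc.eq0_normc.

(** * Rank-one updates of determinants and adjugates *)

(** The block matrix [B] is triangularized in two ways: [E1] shows that [\det B] is the determinant
    sought, and [E2], clearing the row [w], computes [d * \det B]. Multiplying by [d] instead of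
    dividing covers [d = 0]. *)
Lemma det_scalar_add_rank1 (F : idomainType) (n : nat) (d : F) (u : 'cV[F]_n)
    (w : 'rV[F]_n) :
  d * \det (d%:M + u *m w) = d ^+ n * (d + (w *m u) 0 0).
Proof.
pose B := block_mx d%:M (- u) w (1%:M : 'M[F]_1).
have E1 : B = block_mx (d%:M + u *m w) (- u) 0 1%:M *m block_mx 1%:M 0 w 1%:M.
  rewrite mulmx_block !mulmx1 !mulmx0 !mul1mx !add0r mulNmx.
  by rewrite addrK.
have E2 : block_mx 1%:M 0 (- w) d%:M *m B =
    block_mx d%:M (- u) 0 (d%:M + w *m u).
  rewrite mulmx_block !mulmx1 !mul0mx !mul1mx !addr0 !mulNmx mulmxN opprK.
  by rewrite mul_mx_scalar mul_scalar_mx addNr [_ + d%:M]addrC.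
have := congr1 determinant E2; rewrite det_mulmx det_lblock det1 mul1r.
rewrite det_scalar1 det_ublock det_scalar det_mx11 !mxE eqxx mulr1n => <-.
by rewrite E1 det_mulmx det_ublock det_lblock !det1 !mulr1.
Qed.

(* The identity is polynomial in [M], so it suffices to check it for
   [M + 'X], whose determinant is a non-zero-divisor. *)
Lemma det_add_rank1 (F : idomainType) (n : nat) (M : 'M[F]_n) (u : 'cV[F]_n)
    (w : 'rV[F]_n) :
  \det (M + u *m w) = \det M + (w *m \adj M *m u) 0 0.
Proof.
have regular (K : idomainType) (A : 'M[K]_n) (x : 'cV[K]_n) (y : 'rV[K]_n) :
    \det A != 0 -> \det (A + x *m y) = \det A + (y *m \adj A *m x) 0 0.
  move=> dA; apply: (mulfI (expf_neq0 n dA)).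
  (* Multiplying by [\adj A] replaces [A] by the scalar matrix of [\det A], the case already
     settled; a further factor [\det A] makes [\det A ^+ n] appear on both sides. *)
  have E : \adj A *m (A + x *m y) = (\det A)%:M + (\adj A *m x) *m y.
    by rewrite mulmxDr mul_adj_mx mulmxA.
  have := congr1 determinant E; rewrite det_mulmx => /(congr1 ( *%R (\det A))).
  rewrite det_scalar_add_rank1 mulmxA mulrA -det_mulmx mul_mx_adj det_scalar.
  by [].
pose A : 'M[{poly F}]_n := map_mx polyC M + 'X%:M.
have dA : \det A != 0.
  have -> : A = char_poly_mx (- M).
    by rewrite /char_poly_mx /A rmorphN /= opprK addrC.
  by rewrite monic_neq0 // char_poly_monic.
have := regular _ A (map_mx polyC u) (map_mx polyC w) dA.
have horner0 m p (B : 'M[F]_(m, p)) : map_mx (horner_eval 0) (map_mx polyC B) = B.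
  by apply/matrixP => i j; rewrite !mxE /= /horner_eval hornerC.
have A0 : map_mx (horner_eval 0) A = M.
  apply/matrixP => i j; rewrite !mxE /horner_eval hornerD hornerC hornerMn.
  by rewrite hornerX mul0rn addr0.
move=> /(congr1 (horner_eval 0)); rewrite rmorphD /= -!det_map_mx map_mxD.
rewrite map_mxM /= !horner0 A0 => ->; congr (_ + _).
have -> (Y : 'M[{poly F}]_1) :
  horner_eval 0 (Y 0 0) = (map_mx (horner_eval 0) Y) 0 0 by rewrite mxE.
by rewrite !map_mxM /= map_mx_adj !horner0 A0.
Qed.

(** Expanding [\det (M + (u + x) *m w)] in one step or in two gives the same value; what remains is
    the equality of the two rows, tested on every column [x]. *)
Lemma mul_adj_add_rank1 (F : idomainType) (n : nat) (M : 'M[F]_n) (u : 'cV[F]_n)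
    (w : 'rV[F]_n) :
  w *m \adj (M + u *m w) = w *m \adj M.
Proof.
have E (x : 'cV[F]_n) :
    (w *m \adj (M + u *m w) *m x) 0 0 = (w *m \adj M *m x) 0 0.
  have := det_add_rank1 (M + u *m w) x w.
  rewrite -addrA -mulmxDl !det_add_rank1 mulmxDr mxE -addrA => /addrI /addrI.
  by [].
apply/rowP => j; have := E (delta_mx j 0); rewrite -!colE !mxE //.
Qed.

(** * Unitary reflections *)

Section Reflection.
Variable C : numClosedFieldType.
Local Open Scope sesquilinear_scope.

(* At [v = 0] the division by zero makes this the identity. *)
Definition unitary_reflection (n : nat) (z : C) (v : 'cV[C]_n) : 'M[C]_n :=
  1%:M + ((z - 1) / (v ^t* *m v) 0 0) *: (v *m v ^t*).

Lemma adjoint_mul_eq0 n (v : 'cV[C]_n) : (v ^t* *m v) 0 0 = 0 -> v = 0.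
Proof.
rewrite mxE => /eqP; rewrite psumr_eq0; last first.
  by move=> i _; rewrite !mxE mulrC mul_conjC_ge0.
move=> /allP H; apply/colP => i; rewrite [RHS]mxE.
have := H i (mem_index_enum _); rewrite /= !mxE mulrC mul_conjC_eq0 => /eqP.
by [].
Qed.

Lemma mul_adjoint_reflection n (z : C) (v : 'cV[C]_n) :
  v ^t* *m unitary_reflection z v = z *: v ^t*.
Proof.
have vv := mx11_scalar (v ^t* *m v).
have [/adjoint_mul_eq0 ->|nz] := eqVneq ((v ^t* *m v) 0 0) 0.
  by rewrite trmx0 map_mx0 mul0mx scaler0.
rewrite /unitary_reflection mulmxDr mulmx1 -scalemxAr mulmxA.
rewrite {2}vv mul_scalar_mx scalerA divfK //.
by rewrite scalerBl scale1r addrC subrK.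
Qed.

(** The adjoint has the same form with parameter [z^*], and in the product the coefficient of
    [v *m v ^t*] becomes [(z * z^* - 1) / q], which vanishes. *)
Lemma unitary_reflection_unitary n (z : C) (v : 'cV[C]_n) :
  `|z| = 1 -> unitary_reflection z v \is unitarymx.
Proof.
move=> z1; apply/unitarymxP.
set q := (v ^t* *m v) 0 0.
have q_real : q^* = q.
  rewrite /q mxE rmorph_sum; apply: eq_bigr => i _.
  by rewrite !mxE rmorphM /= conjCK mulrC.
have -> : (unitary_reflection z v) ^t* = unitary_reflection z^* v.
  have vv : (v *m v ^t*) ^t* = v *m v ^t*.
    apply/matrixP => i j; rewrite !mxE rmorph_sum; apply: eq_bigr => k _.
    by rewrite !mxE rmorphM /= conjCK mulrC.
  rewrite /unitary_reflection -/q linearD /= trmx1 map_mxD map_mx1 linearZ /=.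
  by rewrite map_mxZ vv /= rmorphM rmorphB fmorphV /= q_real conjC1.
rewrite {1}/unitary_reflection -/q mulmxDl mul1mx -scalemxAl -mulmxA.
rewrite mul_adjoint_reflection /unitary_reflection -/q -scalemxAr scalerA.
rewrite -addrA -scalerDl -[RHS]addr0; congr (_ + _).
have -> : (z^* - 1) / q + (z - 1) / q * z^* = (z * z^* - 1) / q by ring.
by rewrite -normCK z1 expr1n subrr mul0r scale0r.
Qed.

End Reflection.

(** * Measurability of complex functions *)

Section ComplexMeasurable.
Context (d : measure_display) (T : measurableType d) (R : realType).
Implicit Types f g : T -> R[i].

(** Working with real and imaginary parts matches the generators in [cmx_generators]. *)
Definition cmeasurable f :=
  measurable_fun setT (fun x => complex.Re (f x)) /\
  measurable_fun setT (fun x => complex.Im (f x)).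

Lemma cmeasurable_cst (c : R[i]) : cmeasurable (fun=> c).
Proof. by split; exact: measurable_cst. Qed.

Lemma cmeasurableD f g :
  cmeasurable f -> cmeasurable g -> cmeasurable (fun x => f x + g x).
Proof.
move=> [fr fi] [gr gi]; split.
- by under eq_fun do rewrite raddfD /=; exact: measurable_funD.
- by under eq_fun do rewrite raddfD /=; exact: measurable_funD.
Qed.

Lemma cmeasurableM f g :
  cmeasurable f -> cmeasurable g -> cmeasurable (fun x => f x * g x).
Proof.
move=> [fr fi] [gr gi]; split.
- have -> : (fun x => complex.Re (f x * g x)) =
      (fun x => complex.Re (f x) * complex.Re (g x)) \-
      (fun x => complex.Im (f x) * complex.Im (g x)).
    by apply/funext => x /=; case: (f x) (g x) => a b [c e].
  by apply: measurable_funB; exact: measurable_funM.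
- have -> : (fun x => complex.Im (f x * g x)) =
      (fun x => complex.Re (f x) * complex.Im (g x)) \+
      (fun x => complex.Im (f x) * complex.Re (g x)).
    by apply/funext => x /=; case: (f x) (g x) => a b [c e].
  by apply: measurable_funD; exact: measurable_funM.
Qed.

Lemma cmeasurable_conj f : cmeasurable f -> cmeasurable (fun x => (f x)^*).
Proof.
move=> [fr fi]; split.
- have -> // : (fun x => complex.Re (f x)^*) = (fun x => complex.Re (f x)).
  by apply/funext => x; case: (f x).
- have -> : (fun x => complex.Im (f x)^*) = \- (fun x => complex.Im (f x)).
    by apply/funext => x /=; case: (f x).
  exact: measurable_funN.
Qed.

Lemma cmeasurable_sum (I : Type) (s : seq I) (h : I -> T -> R[i]) :
  (forall i, cmeasurable (h i)) -> cmeasurable (fun x => \sum_(i <- s) h i x).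
Proof.
move=> mh; elim: s => [|i s ih].
  by under eq_fun do rewrite big_nil; exact: cmeasurable_cst.
by under eq_fun do rewrite big_cons; exact: cmeasurableD.
Qed.

Lemma cmeasurable_prod (I : Type) (s : seq I) (h : I -> T -> R[i]) :
  (forall i, cmeasurable (h i)) -> cmeasurable (fun x => \prod_(i <- s) h i x).
Proof.
move=> mh; elim: s => [|i s ih].
  by under eq_fun do rewrite big_nil; exact: cmeasurable_cst.
by under eq_fun do rewrite big_cons; exact: cmeasurableM.
Qed.

Definition mx_cmeasurable m n (F : T -> 'M[R[i]]_(m, n)) :=
  forall i j, cmeasurable (fun x => F x i j).

Lemma mx_cmeasurable_cst m n (A : 'M[R[i]]_(m, n)) : mx_cmeasurable (fun=> A).
Proof. by move=> i j; exact: cmeasurable_cst. Qed.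

Lemma mx_cmeasurableD m n (F G : T -> 'M[R[i]]_(m, n)) :
  mx_cmeasurable F -> mx_cmeasurable G -> mx_cmeasurable (fun x => F x + G x).
Proof.
by move=> mF mG i j; under eq_fun do rewrite mxE; exact: cmeasurableD.
Qed.

Lemma mx_cmeasurableM m n p (F : T -> 'M[R[i]]_(m, n)) (G : T -> 'M[R[i]]_(n, p)) :
  mx_cmeasurable F -> mx_cmeasurable G -> mx_cmeasurable (fun x => F x *m G x).
Proof.
move=> mF mG i j; under eq_fun do rewrite mxE.
by apply: cmeasurable_sum => k; exact: cmeasurableM.
Qed.

Lemma cmeasurable_det n (F : T -> 'M[R[i]]_n) :
  mx_cmeasurable F -> cmeasurable (fun x => \det (F x)).
Proof.
move=> mF; apply: cmeasurable_sum => s; apply: cmeasurableM.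
  exact: cmeasurable_cst.
by apply: cmeasurable_prod => i; exact: mF.
Qed.

Lemma mx_cmeasurable_adj n (F : T -> 'M[R[i]]_n) :
  mx_cmeasurable F -> mx_cmeasurable (fun x => \adj (F x)).
Proof.
move=> mF i j; under eq_fun do rewrite mxE /cofactor.
apply: cmeasurableM; first exact: cmeasurable_cst.
apply: cmeasurable_det => k l; under eq_fun do rewrite !mxE.
exact: mF.
Qed.

Lemma normc_sqr (z : R[i]) :
  normc z ^+ 2 = complex.Re z ^+ 2 + complex.Im z ^+ 2.
Proof. by case: z => a b /=; rewrite sqr_sqrtr // addr_ge0 // sqr_ge0. Qed.

Lemma measurable_normc_sqr f : cmeasurable f ->
  measurable_fun setT (fun x => normc (f x) ^+ 2).
Proof.
move=> [fr fi]; under eq_fun do rewrite normc_sqr.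
by apply: measurable_funD; exact: measurable_funX.
Qed.

Lemma measurable_le_set (f g : T -> R) :
  measurable_fun setT f -> measurable_fun setT g ->
  measurable [set x | f x <= g x].
Proof.
move=> mf mg; have := measurable_fun_ler mf mg measurableT (Y := [set true]).
by rewrite setTI preimage_true; apply.
Qed.

Lemma measurable_eq_set f g : cmeasurable f -> cmeasurable g ->
  measurable [set x | f x = g x].
Proof.
move=> [fr fi] [gr gi].
have -> : [set x | f x = g x] =
    [set x | complex.Re (f x) == complex.Re (g x)] `&`
    [set x | complex.Im (f x) == complex.Im (g x)].
  apply/seteqP; split => x /=; first by move=> ->.
  by case: (f x) (g x) => a b [c e] /= [/eqP -> /eqP ->].
have m (u v : T -> R) : measurable_fun setT u -> measurable_fun setT v ->
    measurable [set x | u x == v x].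
  move=> mu mv; have := measurable_fun_eqr mu mv measurableT (Y := [set true]).
  by rewrite setTI preimage_true; apply.
by apply: measurableI; exact: m.
Qed.

End ComplexMeasurable.

(** * Expected counts and union bounds *)

Section Counting.
Local Open Scope ereal_scope.
Context (d : measure_display) (T : measurableType d) (R : realType).
Variable P : probability T R.

(** The sum is the expected number of events that occur, so a pointwise bound on that number
    suffices. *)
Lemma sum_probability_le (I : finType) (S : I -> set T) (K : R) :
  (forall i, measurable (S i)) ->
  (forall x, (#|[set i | `[< S i x >] ]%SET|%:R <= K)%R) ->
  \sum_(i : I) P (S i) <= K%:E.
Proof.
move=> mS HK.
have -> : \sum_(i : I) P (S i) = \int[P]_x (\sum_(i : I) (\1_(S i) x)%:E).
  rewrite ge0_integral_sum //.
  - by apply: eq_bigr => i _; rewrite integral_indic // setIT.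
  - by move=> i; apply/measurable_EFinP.
rewrite -[leRHS]mule1 -(@probability_setT _ _ _ P) -integral_cst //.
apply: ge0_le_integral => //.
- by move=> x _; apply: sume_ge0.
- by apply: emeasurable_sum => i; apply/measurable_EFinP.
- move=> x _; rewrite /cst sumEFin lee_fin; apply: le_trans (HK x).
  rewrite -sum1_card natr_sum [leRHS]big_mkcond /=; apply: ler_sum => i _.
  rewrite finset.inE indicE; have -> : (x \in S i) = `[< S i x >] by [].
  by case: asboolP => //= _; rewrite lexx.
Qed.

Lemma probability_bigsetU_le (I : Type) (s : seq I) (S : I -> set T) :
  (forall i, measurable (S i)) ->
  P (\big[setU/set0]_(i <- s) S i) <= \sum_(i <- s) P (S i).
Proof.
move=> mS; elim: s => [|i s ih]; first by rewrite !big_nil measure0.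
rewrite !big_cons; apply: le_trans (leeD2l _ ih).
by apply: measureU2 => //; exact: bigsetU_measurable.
Qed.
End Counting.

(** * The complex modulus and the unit circle *)

Section ComplexNorm.
Variable R : realType.
Implicit Types z w : R[i].

Lemma normc_ge0 z : 0 <= normc z.
Proof. by case: z => a b; exact: sqrtr_ge0. Qed.

Lemma normc_gt0 z : (0 < normc z) = (z != 0).
Proof.
rewrite lt0r normc_ge0 andbT; congr (~~ _).
by apply/eqP/eqP => [/eq0_normc //|->]; exact: normc0.
Qed.

Lemma normr_normc z : `|z| = (normc z)%:C%C.
Proof. by case: z. Qed.

Lemma normc_eq1 z : `|z| = 1 -> normc z = 1.
Proof. by rewrite normr_normc => -[]. Qed.

Lemma le_normc_sum (I : Type) (s : seq I) (F : I -> R[i]) :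
  normc (\sum_(i <- s) F i) <= \sum_(i <- s) normc (F i).
Proof.
elim/big_ind2 : _ => [|x1 x2 y1 y2 h1 h2|//]; first by rewrite normc0.
exact: le_trans (le_normcD _ _) (lerD h1 h2).
Qed.

(* The Cayley transform [(1 + i t) / (1 - i t)]. *)
Definition circle_point (t : R) : R[i] :=
  ((1 - t ^+ 2) / (1 + t ^+ 2) +i* (2 * t / (1 + t ^+ 2)))%C.

Lemma norm_circle_point t : `|circle_point t| = 1.
Proof.
have p : 1 + t ^+ 2 != 0 by rewrite gt_eqF // ltr_pwDl // sqr_ge0.
rewrite normr_normc /circle_point /=.
have -> : ((1 - t ^+ 2) / (1 + t ^+ 2)) ^+ 2 + (2 * t / (1 + t ^+ 2)) ^+ 2 = 1.
  by field.
by rewrite sqrtr1.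
Qed.

(** The squared chord is [4 * (t - s) ^+ 2 / ((1 + t ^+ 2) * (1 + s ^+ 2))], and each factor of the
    denominator is at most 2 on the unit interval. *)
Lemma circle_point_dist t s : 0 <= t <= 1 -> 0 <= s <= 1 ->
  `|t - s| <= normc (circle_point t - circle_point s).
Proof.
move=> /andP[t0 t1] /andP[s0 s1].
have pt : 1 <= 1 + t ^+ 2 <= 2 by nra.
have ps : 1 <= 1 + s ^+ 2 <= 2 by nra.
rewrite -ler_sqr ?nnegrE ?normc_ge0 // real_normK ?num_real // normc_sqr.
have -> : complex.Re (circle_point t - circle_point s) ^+ 2 +
          complex.Im (circle_point t - circle_point s) ^+ 2 =
    4 * (t - s) ^+ 2 / ((1 + t ^+ 2) * (1 + s ^+ 2)).
  by rewrite /=; field; apply/andP; split; apply/eqP; nra.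
rewrite ler_pdivlMr; last by nra.
rewrite mulrC; apply: ler_wpM2r; first exact: sqr_ge0.
by nra.
Qed.

End ComplexNorm.

(** All indices in [S] lie between the least, [m], and the greatest, [M], so there are at most
    [M - m + 1] of them. *)
Lemma card_le_diameter (R : realType) (N : nat) (S : {set 'I_N}) (d : R) :
  0 <= d ->
  (forall k l : 'I_N, k \in S -> l \in S -> `|k%:R - l%:R| <= d) ->
  #|S|%:R <= 1 + d.
Proof.
move=> d0 H; have [->|[k0 k0S]] := set_0Vmem S.
  by rewrite cards0 addr_ge0.
pose m := [arg min_(k < k0 | k \in S) (k : nat)].
pose M := [arg max_(k > k0 | k \in S) (k : nat)].
have [mS mmin] : m \in S /\ forall j, j \in S -> (m <= j)%N.
  by rewrite /m; case: arg_minnP.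
have [MS Mmax] : M \in S /\ forall j, j \in S -> (j <= M)%N.
  by rewrite /M; case: arg_maxnP.
have le_mM : (m <= M)%N by exact: mmin.
have : (#|S| <= (M - m).+1)%N.
  rewrite cardE -(size_map val) -(size_iota m (M - m).+1).
  apply: uniq_leq_size; first by rewrite map_inj_uniq ?enum_uniq //; exact: val_inj.
  move=> _ /mapP[j + ->]; rewrite mem_enum => jS.
  by rewrite mem_iota mmin // addnS subnKC // ltnS Mmax.
rewrite -(ler_nat R) => /le_trans; apply.
rewrite -natr1 addrC lerD2l natrB //.
by apply: le_trans (H M m MS mS); exact: ler_norm.
Qed.

(** * Reflections and polarization *)

Section QuadraticForm.
Variable R : realType.
Local Open Scope sesquilinear_scope.

Definition qform n (v : 'cV[R[i]]_n) (A : 'M[R[i]]_n) : R[i] :=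
  (v ^t* *m A *m v) 0 0.

Definition det_add n (D U : 'M[R[i]]_n) : R[i] := \det (D + U).

(** The left factor [U] comes from the row [v ^t* *m U] of the rank-one shift in [reflection_shift];
    with it, [det_add_rank1] produces exactly [qform v]. *)
Definition mul_adj n (D U : 'M[R[i]]_n) : 'M[R[i]]_n := U *m \adj (D + U).

Lemma reflection_shift n (D U : 'M[R[i]]_n) (z : R[i]) (v : 'cV[R[i]]_n) :
  D + unitary_reflection z v *m U =
  D + U + ((z - 1) / (v ^t* *m v) 0 0 *: v) *m (v ^t* *m U).
Proof.
by rewrite /unitary_reflection mulmxDl mul1mx addrA -!scalemxAl !mulmxA.
Qed.

Lemma det_reflection n (D U : 'M[R[i]]_n) (z : R[i]) (v : 'cV[R[i]]_n) :
  det_add D (unitary_reflection z v *m U) =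
  det_add D U + (z - 1) * (qform v (mul_adj D U) / (v ^t* *m v) 0 0).
Proof.
rewrite /det_add reflection_shift det_add_rank1; congr (_ + _).
by rewrite -scalemxAr mxE /qform /mul_adj !mulmxA mulrAC mulrA.
Qed.

(** The reflection multiplies [v ^t*] by [z], and the remaining row [v ^t* *m U] is the row of the
    rank-one shift, whose product with the adjugate is unchanged by [mul_adj_add_rank1]. *)
Lemma qform_reflection n (D U : 'M[R[i]]_n) (z : R[i]) (v : 'cV[R[i]]_n) :
  qform v (mul_adj D (unitary_reflection z v *m U)) =
  z * qform v (mul_adj D U).
Proof.
rewrite /qform /mul_adj !mulmxA mul_adjoint_reflection -!scalemxAl mxE.
by rewrite reflection_shift mul_adj_add_rank1.
Qed.

Definition polar_vector n (w : R[i]) (i j : 'I_n) : 'cV[R[i]]_n :=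
  delta_mx i 0 + w *: delta_mx j 0.

Lemma qform_polar n (w : R[i]) (i j : 'I_n) (A : 'M[R[i]]_n) :
  qform (polar_vector w i j) A =
  A i i + w * A i j + w^* * A j i + w * w^* * A j j.
Proof.
rewrite /qform.
have -> : (polar_vector w i j) ^t* = delta_mx 0 i + w^* *: delta_mx 0 j.
  apply/rowP => k; by rewrite !mxE !andbT rmorphD rmorphM /= !rmorph_nat.
rewrite /polar_vector mulmxDl mulmxDr !mulmxDl -!scalemxAl -!scalemxAr.
rewrite -!rowE -!colE !mxE; ring.
Qed.

(** The value is 2 for distinct indices; 4 allows for [i = j], where the vector is [1 + w] times a
    basis vector. *)
Lemma norm_polar_vector n (w : R[i]) (i j : 'I_n) : `|w| = 1 ->
  normc (((polar_vector w i j) ^t* *m polar_vector w i j) 0 0) <= 4.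
Proof.
move=> w1; have := qform_polar w i j 1%:M.
rewrite /qform mulmx1 => ->; rewrite -normCK w1 expr1n mul1r !mxE !eqxx.
have nw : normc w = 1 by apply: normc_eq1.
have nw' : normc w^* = 1 by apply: normc_eq1; rewrite norm_conjC.
have nb (b : bool) : normc (b%:R : R[i]) <= 1.
  by case: b; rewrite ?normc0 // (normc_eq1 (normr1 _)).
have tri (x y : R[i]) (a b : R) :
    normc x <= a -> normc y <= b -> normc (x + y) <= a + b.
  by move=> hx hy; exact: le_trans (le_normcD _ _) (lerD hx hy).
have -> : 4 = 1 + 1 + 1 + 1 :> R by ring.
apply: (tri); last exact: (nb true).
apply: (tri); last by rewrite normcM nw' mul1r.
by apply: (tri); [exact: (nb true) | rewrite normcM nw mul1r].
Qed.

Definition unit4 (k : 'I_4) : R[i] := 'i ^+ k.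

Lemma norm_unit4 k : `|unit4 k| = 1.
Proof. by rewrite /unit4 normrX normCi expr1n. Qed.

(** Summing the four forms with weights [(unit4 k)^*] cancels the other entries and leaves
    [4 * A i j], so the four forms cannot all be smaller than [A i j] in modulus. *)
Lemma polarization n (i j : 'I_n) (A : 'M[R[i]]_n) :
  exists k : 'I_4, normc (A i j) <= normc (qform (polar_vector (unit4 k) i j) A).
Proof.
apply: contrapT => /forallNP H.
have {}H k : normc (qform (polar_vector (unit4 k) i j) A) < normc (A i j).
  by rewrite ltNge; apply/negP; exact: H.
have E : 4 * A i j =
    \sum_(k < 4) (unit4 k)^* * qform (polar_vector (unit4 k) i j) A.
  rewrite !big_ord_recl big_ord0 /unit4 /= !qform_polar.
  rewrite !exprS expr0 !rmorphM /= !rmorph1 conjCi.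
  have i2 : ('i : R[i]) * 'i = -1 by rewrite -expr2 sqrCi.
  ring: i2.
have : normc (4 * A i j) <=
    \sum_(k < 4) normc (qform (polar_vector (unit4 k) i j) A).
  rewrite E; apply: le_trans (le_normc_sum _ _) _; apply: ler_sum => k _.
  by rewrite normcM (@normc_eq1 _ (unit4 k)^*) ?mul1r // norm_conjC norm_unit4.
apply/negP; rewrite -ltNge normcM.
have -> : normc (4 : R[i]) = 4.
  have : `|4 : R[i]| = 4 by rewrite normr_nat.
  by rewrite normr_normc => /(congr1 (@complex.Re R)) /= ->.
have -> : 4 * normc (A i j) = \sum_(k < 4) normc (A i j).
  by rewrite sumr_const card_ord mulr_natl.
apply: ltr_sum => [|k _]; last exact: H.
by apply/hasP; exists ord0 => //; exact: mem_index_enum.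
Qed.

End QuadraticForm.

(** * Averaging over reflections *)

Section Events.
Variables (R : realType) (n : nat).
Local Open Scope sesquilinear_scope.
Implicit Types D U : 'M[R[i]]_n.

(** The condition [det_add D U != 0] forces the form to be nonzero; otherwise both could vanish
    along a whole orbit of reflections, and no count of hits would be small. *)
Definition near_singular D (kappa : R) (v : 'cV[R[i]]_n) : set (cmxM R n) :=
  [set U | det_add D U != 0 /\
           normc (det_add D U) <= kappa * normc (qform v (mul_adj D U))].

(** The average over the circle is discretized: these [N] points lie on the quarter circle from 1 to
    ['i], and finitely many unitaries then suffice. They are not equally spaced, only well
    separated. *)
Definition grid_point (N : nat) (k : 'I_N) : R[i] := circle_point (k%:R / N%:R).

Lemma grid_point_dist (N : nat) (k l : 'I_N) :
  `|k%:R - l%:R| <= N%:R * normc (grid_point k - grid_point l).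
Proof.
have N0 : 0 < N%:R :> R by rewrite ltr0n (leq_trans _ (ltn_ord k)).
have I (m : 'I_N) : 0 <= (m%:R / N%:R : R) <= 1.
  by rewrite divr_ge0 ?ler0n //= ler_pdivrMr // mul1r ler_nat ltnW.
rewrite mulrC -ler_pdivrMr //; apply: le_trans (circle_point_dist (I k) (I l)).
by rewrite -mulrBl normrM normfV (gtr0_norm N0).
Qed.

(** Two hits have determinants differing by at most [2 * kappa * normc q], while the difference is
    [q / r] times that of the grid points. The latter are thus within
    [2 * kappa * normc r <= 8 * kappa], which [grid_point_dist] turns into a bound on the
    indices. *)
Lemma card_near_singular D U (kappa : R) (v : 'cV[R[i]]_n) (N : nat) :
  0 <= kappa -> normc ((v ^t* *m v) 0 0) <= 4 ->
  #|[set k : 'I_N |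
     `[< near_singular D kappa v (unitary_reflection (grid_point k) v *m U) >]]%SET|%:R
    <= 1 + N%:R * (8 * kappa).
Proof.
move=> kappa0 v4.
set q := qform v (mul_adj D U); set r := (v ^t* *m v) 0 0.
have r0q : r = 0 -> q = 0.
  by move=> /adjoint_mul_eq0 v0; rewrite /q /qform v0 mulmx0 mxE.
apply: card_le_diameter; first by rewrite mulr_ge0 ?ler0n // mulr_ge0.
have hit (k : 'I_N) :
    near_singular D kappa v (unitary_reflection (grid_point k) v *m U) ->
    det_add D U + (grid_point k - 1) * (q / r) != 0 /\
    normc (det_add D U + (grid_point k - 1) * (q / r)) <= kappa * normc q.
  rewrite /near_singular /= det_reflection qform_reflection -/q -/r normcM.
  by rewrite (normc_eq1 (norm_circle_point _)) mul1r.
move=> k l; rewrite !finset.inE => /asboolP/hit[fk0 fk] /asboolP/hit[_ fl].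
have q0 : q != 0.
  apply: contraNN fk0 => /eqP q0; move: fk.
  rewrite q0 normc0 mulr0 mul0r mulr0 addr0 => h.
  apply/eqP/eq0_normc/eqP; rewrite eq_le normc_ge0 andbT.
  by [].
have r0 : r != 0 by apply: contraNN q0 => /eqP/r0q ->.
apply: le_trans (grid_point_dist k l) _; apply: ler_wpM2l; first exact: ler0n.
have nq : 0 < normc (q / r) by rewrite normc_gt0 mulf_neq0 ?invr_neq0.
rewrite -(ler_pM2r nq) -normcM.
have -> : (grid_point k - grid_point l) * (q / r) =
    (det_add D U + (grid_point k - 1) * (q / r)) -
    (det_add D U + (grid_point l - 1) * (q / r)) by ring.
apply: le_trans (le_normcD _ _) _; rewrite normcN.
apply: le_trans (lerD fk fl) _.
have -> : normc q = normc (q / r) * normc r by rewrite -normcM divfK.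
have : kappa * normc (q / r) * normc r <= kappa * normc (q / r) * 4.
  by apply: ler_wpM2l => //; rewrite mulr_ge0 // ltW.
lra.
Qed.

Lemma mx_cmeasurable_id : mx_cmeasurable (fun U : cmxM R n => U : 'M[R[i]]_n).
Proof.
move=> i j; split=> _ B mB; rewrite setTI; apply: sub_sigma_algebra.
- by exists i, j, B; split; [|left].
- by exists i, j, B; split; [|right].
Qed.

Lemma mx_cmeasurable_mull (V : 'M[R[i]]_n) :
  mx_cmeasurable (fun U : cmxM R n => V *m (U : 'M[R[i]]_n)).
Proof. exact: mx_cmeasurableM (mx_cmeasurable_cst _ _) mx_cmeasurable_id. Qed.

Lemma cmeasurable_det_shift D (F : cmxM R n -> 'M[R[i]]_n) :
  mx_cmeasurable F -> cmeasurable (fun U : cmxM R n => det_add D (F U)).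
Proof.
move=> mF; apply: cmeasurable_det.
by apply: mx_cmeasurableD => //; exact: mx_cmeasurable_cst.
Qed.

(** A general [F] covers both the event and its translates [V *m U]. Squaring the moduli makes both
    sides polynomial in real and imaginary parts. *)
Lemma measurable_near_singular D (kappa : R) v (F : cmxM R n -> 'M[R[i]]_n) :
  0 <= kappa -> mx_cmeasurable F ->
  measurable [set U : cmxM R n | near_singular D kappa v (F U)].
Proof.
move=> kappa0 mF.
have -> : [set U : cmxM R n | near_singular D kappa v (F U)] =
    ~` [set U : cmxM R n | det_add D (F U) = 0] `&`
    [set U : cmxM R n | normc (det_add D (F U)) ^+ 2 <=
             kappa ^+ 2 * normc (qform v (mul_adj D (F U))) ^+ 2].
  apply/seteqP; split=> U /=; rewrite -exprMn.
  - case=> f0 h; split; first by apply/eqP.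
    by rewrite ler_sqr // nnegrE ?mulr_ge0 ?normc_ge0.
  - case=> /eqP f0 h; split => //; move: h.
    by rewrite ler_sqr // nnegrE ?mulr_ge0 ?normc_ge0.
have mdet := cmeasurable_det_shift D mF.
apply: measurableI.
  by apply: measurableC; apply: measurable_eq_set => //; exact: cmeasurable_cst.
apply: measurable_le_set; first exact: measurable_normc_sqr.
apply: measurable_funM; first exact: measurable_cst.
apply: measurable_normc_sqr.
have cst m p (B : 'M[R[i]]_(m, p)) : mx_cmeasurable (fun _ : cmxM R n => B).
  exact: mx_cmeasurable_cst.
have : mx_cmeasurable (fun U : cmxM R n => v ^t* *m mul_adj D (F U) *m v).
  apply: mx_cmeasurableM => //; apply: mx_cmeasurableM => //.
  apply: mx_cmeasurableM => //.
  by apply: mx_cmeasurable_adj; apply: mx_cmeasurableD.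
by apply.
Qed.

Lemma measurable_unitary : measurable [set U : cmxM R n | U \is unitarymx].
Proof.
have -> : [set U : cmxM R n | U \is unitarymx] =
    \bigcap_(p in [set: 'I_n * 'I_n])
      [set U : cmxM R n | ((U : 'M[R[i]]_n) *m U ^t*) p.1 p.2 =
                          (1%:M : 'M[R[i]]_n) p.1 p.2].
  apply/seteqP; split=> U /=; first by move=> /unitarymxP h p _; rewrite /= h.
  by move=> h; apply/unitarymxP/matrixP => i j; exact: (h (i, j)).
apply: fin_bigcap_measurable => // p _.
apply: measurable_eq_set; last exact: cmeasurable_cst.
apply: mx_cmeasurableM; first exact: mx_cmeasurable_id.
move=> i j; under eq_fun do rewrite !mxE.
by apply: cmeasurable_conj; exact: mx_cmeasurable_id.
Qed.

Section Haar.
Variable P : probability (cmxM R n) R.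
Hypothesis haarP : is_haar_unitary P.
Local Open Scope ereal_scope.

(** By invariance each translate of [A] has probability [P A], so [N * P A] is the expected number
    of [k] with [V k *m U] in [A]. *)
Lemma haar_average (N : nat) (V : 'I_N -> 'M[R[i]]_n) (A : set (cmxM R n)) (K : R) :
  (forall k, V k \is unitarymx) -> measurable A ->
  (forall k, measurable [set U : cmxM R n | A (V k *m U)]) ->
  (forall U : 'M[R[i]]_n, U \is unitarymx ->
     (#|[set k | `[< A (V k *m U) >]]%SET|%:R <= K)%R) -> (0 <= K)%R ->
  N%:R%:E * P A <= K%:E.
Proof.
move=> uV mA mS HK K0; have [P1 inv] := haarP.
(* The count is bounded only at unitary [U]; intersecting with the unitary group makes it 0
   elsewhere and changes no probability. *)
pose S k := [set U : cmxM R n | A (V k *m U)] `&` [set U | U \is unitarymx].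
have mU := measurable_unitary.
have PS k : P (S k) = P A.
  rewrite -(inv (V k) (uV k) A mA).
  have -> : [set U : cmxM R n | V k *m U \in A] = [set U : cmxM R n | A (V k *m U)].
    by apply/seteqP; split=> U /=; rewrite inE.
  have mS' : measurable (S k) by exact: measurableI.
  apply/eqP; rewrite eq_le; apply/andP; split.
    by apply: le_measure; rewrite ?inE //; exact: subIsetl.
  have PC : P (~` [set U : cmxM R n | U \is unitarymx]) = 0.
    by rewrite probability_setC // P1 subee.
  rewrite -[leRHS]adde0 -PC; apply: le_trans (measureU2 _ _ _) => //; last first.
    exact: measurableC.
  apply: le_measure; rewrite ?inE //.
    by apply: measurableU => //; exact: measurableC.
  by move=> U AU; have [uU|nU] := pselect (U \is unitarymx); [left|right].
have -> : N%:R%:E * P A = \sum_(k < N) P (S k).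
  by rewrite (eq_bigr _ (fun k _ => PS k)) sumr_const card_ord mule_natl.
apply: sum_probability_le; first by move=> k; exact: measurableI.
move=> U; have [uU|nU] := pselect (U \is unitarymx).
  apply: le_trans (HK U uU); rewrite ler_nat; apply: subset_leq_card.
  apply/fintype.subsetP => k; rewrite !finset.inE => /asboolP[h _].
  exact/asboolP.
rewrite (_ : [set k | _]%SET = finset.set0) ?cards0 //.
by apply/setP => k; rewrite !finset.inE; apply/asboolP => -[].
Qed.

(** The term [N%:R^-1] is the discretization error, from the [1 +] in the count; [N] is free and
    later tends to infinity. *)
Lemma P_near_singular D (kappa : R) (v : 'cV[R[i]]_n) (N : nat) :
  (0 <= kappa)%R -> (normc ((v ^t* *m v) ord0 ord0) <= 4)%R -> (0 < N)%N ->
  P (near_singular D kappa v) <= (8 * kappa + N%:R^-1)%:E.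
Proof.
move=> kappa0 v4 N0.
have N0' : (0 < N%:R :> R)%R by rewrite ltr0n.
have := @haar_average N (fun k => unitary_reflection (grid_point k) v)
  (near_singular D kappa v) (1 + N%:R * (8 * kappa)).
have mns F := @measurable_near_singular D kappa v F kappa0.
have H0 : (0 <= 1 + N%:R * (8 * kappa))%R by rewrite addr_ge0 ?mulr_ge0.
move=> /(_ _ (mns _ mx_cmeasurable_id) _ _ H0) H.
rewrite -(@lee_pmul2l _ N%:R%:E) //; apply: le_trans (H _ _ _) _.
- by move=> k; apply: unitary_reflection_unitary; exact: norm_circle_point.
- by move=> k; apply: mns; exact: mx_cmeasurable_mull.
- by move=> U _; exact: card_near_singular.
- by rewrite -EFinM lee_fin mulrDr divff ?gt_eqF // addrC.
Qed.

End Haar.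
End Events.

(** * Singular matrices [D + U] have small probability *)

Section SingularNull.
Variables (R : realType) (n : nat).
Local Open Scope sesquilinear_scope.
Implicit Types D U : 'M[R[i]]_n.

Lemma horner_char_poly (F : comNzRingType) m (A : 'M[F]_m) (z : F) :
  (char_poly A).[z] = \det (z%:M - A).
Proof.
rewrite -[LHS]/(horner_eval z _) -det_map_mx; congr determinant.
apply/matrixP => i j.
by rewrite /char_poly_mx !mxE /= /horner_eval hornerD hornerN hornerC hornerMn hornerX.
Qed.

Lemma grid_point_inj N : injective (@grid_point R N).
Proof.
move=> k l kl; have := grid_point_dist R k l.
rewrite kl subrr normc0 mulr0 normr_le0 subr_eq0 eqr_nat => /eqP kl'.
exact: val_inj.
Qed.

(** If [D + z U] is singular then [z] is a root of the characteristic polynomial of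
    [- (invmx U *m D)], of degree [n], and the grid points are distinct. *)
Lemma card_singular D U N : U \in unitmx ->
  (#|[set k : 'I_N | (det_add D ((grid_point R k)%:M *m U) == 0)%R]%SET| <= n)%N.
Proof.
move=> uU; set S := finset.finset _.
pose p := char_poly (- (invmx U *m D)).
have p0 : p != 0 by rewrite monic_neq0 // char_poly_monic.
rewrite -ltnS -(size_char_poly (- (invmx U *m D))) cardE -(size_map (@grid_point R N)).
apply: max_poly_roots => //; last first.
  by rewrite map_inj_uniq ?enum_uniq //; exact: grid_point_inj.
apply/allP => _ /mapP[k + ->]; rewrite mem_enum finset.inE /det_add => /eqP dk.
rewrite /root horner_char_poly opprK.
have dU : \det U != 0 by rewrite -unitfE -unitmxE.
rewrite -(mulrI_eq0 _ (lregP dU)) -det_mulmx mulmxDr mulKVmx //.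
by rewrite mul_mx_scalar addrC -mul_scalar_mx dk.
Qed.

Lemma scalar_unitary (z : R[i]) : `|z| = 1 -> (z%:M : 'M[R[i]]_n) \is unitarymx.
Proof.
move=> z1; apply/unitarymxP; rewrite tr_scalar_mx map_scalar_mx -scalar_mxM.
by rewrite -normCK z1 expr1n.
Qed.

Lemma P_singular (P : probability (cmxM R n) R) D N : is_haar_unitary P ->
  (0 < N)%N ->
  (P [set U : cmxM R n | (det_add D U = 0)%R] <= (n%:R / N%:R)%:E)%E.
Proof.
move=> haarP N0.
have N0' : (0 < N%:R :> R)%R by rewrite ltr0n.
have mD (F : cmxM R n -> 'M[R[i]]_n) : mx_cmeasurable F ->
    measurable [set U : cmxM R n | det_add D (F U) = 0].
  move=> mF; apply: measurable_eq_set; last exact: cmeasurable_cst.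
  exact: cmeasurable_det_shift.
rewrite -(@lee_pmul2l _ N%:R%:E) //.
apply: le_trans (haar_average haarP (V := fun k => (grid_point R k)%:M)
  (K := n%:R) _ _ _ _ _) _ => //.
- by move=> k; apply: scalar_unitary; exact: norm_circle_point.
- by apply: mD; exact: mx_cmeasurable_id.
- by move=> k; apply: mD; exact: mx_cmeasurable_mull.
- move=> U uU; rewrite ler_nat.
  apply: leq_trans (card_singular D N (unitarymx_unit uU)).
  apply: subset_leq_card; apply/fintype.subsetP => k.
  by rewrite !finset.inE => /asboolP /= ->.
- by rewrite -EFinM lee_fin mulrC divfK // gt_eqF.
Qed.

End SingularNull.

(** * The smallest singular value *)

Section SmallestSV.
Variables (R : realType) (n : nat).
Local Open Scope sesquilinear_scope.
Implicit Types (D U M : 'M[R[i]]_n) (x : 'cV[R[i]]_n).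

Definition sqnorm x : R := \sum_(i < n) normc (x i ord0) ^+ 2.

Lemma sqnorm_ge0 x : 0 <= sqnorm x.
Proof. by apply: sumr_ge0 => i _; exact: sqr_ge0. Qed.

Lemma vnorm2E x : vnorm2 x = Num.sqrt (sqnorm x). Proof. by []. Qed.

Lemma vnorm2_lt x a : 0 <= a -> (vnorm2 x < a) = (sqnorm x < a ^+ 2).
Proof.
move=> a0; rewrite vnorm2E -ltr_sqr ?nnegrE ?sqrtr_ge0 //.
by rewrite sqr_sqrtr ?sqnorm_ge0.
Qed.

Lemma vnorm2_eq1 x : vnorm2 x = 1 <-> sqnorm x = 1.
Proof.
rewrite vnorm2E; split=> [h|->]; last by rewrite sqrtr1.
by rewrite -(sqr_sqrtr (sqnorm_ge0 x)) h expr1n.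
Qed.

Lemma sqnormZ (r : R) x : sqnorm (r%:C%C *: x) = r ^+ 2 * sqnorm x.
Proof.
rewrite /sqnorm mulr_sumr; apply: eq_bigr => i _.
rewrite mxE normcM exprMn; congr (_ * _).
by rewrite normc_sqr /= expr0n addr0.
Qed.

Lemma sqnormE x : (sqnorm x)%:C%C = (x ^t* *m x) 0 0.
Proof.
rewrite mxE rmorph_sum; apply: eq_bigr => i _.
by rewrite !mxE rmorphXn /= -normr_normc sqr_normc mulrC.
Qed.

Lemma sqnorm_unitary U x : U \is unitarymx -> sqnorm (U *m x) = sqnorm x.
Proof.
move=> /unitarymxP /mulmx1C uU; apply: complexI; rewrite !sqnormE.
by rewrite trmx_mul map_mxM /= mulmxA -(mulmxA _ _ U) uU mulmx1.
Qed.

(** Needed to use [inf]: for [n = 0] the sphere is empty and [inf] takes a default value. *)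
Lemma sphere_image_neq0 M : (0 < n)%N ->
  [set vnorm2 (M *m x) | x in [set x : 'cV[R[i]]_n | vnorm2 x = 1]] !=set0.
Proof.
move=> n0; pose i0 := Ordinal n0.
exists (vnorm2 (M *m delta_mx i0 0)); exists (delta_mx i0 0) => //=.
apply/vnorm2_eq1; rewrite /sqnorm (bigD1 i0) //= big1 => [|i ii0].
  by rewrite mxE !eqxx addr0 normc_sqr /= expr1n expr0n addr0.
by rewrite mxE (negPf ii0) normc_sqr /= expr0n addr0.
Qed.

(** Homogeneity removes the constraint to the unit sphere, leaving a condition that can be tested on
    rational vectors. The strict inequality already excludes [x = 0]. *)
Lemma smallest_sv_ltP M (a : R) : (0 < n)%N -> 0 < a ->
  smallest_sv M < a <-> exists x, sqnorm (M *m x) < a ^+ 2 * sqnorm x.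
Proof.
move=> n0 a0; split=> [/(inf_lt (sphere_image_neq0 M n0))[_ [x /= x1 <-]]|[x hx]].
  rewrite (vnorm2_lt _ (ltW a0)) => h; exists x.
  by move/vnorm2_eq1 : x1 => ->; rewrite mulr1.
have x0 : 0 < sqnorm x.
  rewrite lt0r sqnorm_ge0 andbT; apply/eqP => x0; move: hx.
  by rewrite x0 mulr0 ltNge sqnorm_ge0.
pose r := (Num.sqrt (sqnorm x))^-1.
have r2 : r ^+ 2 = (sqnorm x)^-1 by rewrite exprVn sqr_sqrtr // ltW.
apply: (@le_lt_trans _ _ (vnorm2 (M *m (r%:C%C *: x)))).
  apply: ge_inf; first by exists 0 => _ [y _ <-]; exact: sqrtr_ge0.
  exists (r%:C%C *: x) => //=; apply/vnorm2_eq1.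
  by rewrite sqnormZ r2 mulVf // gt_eqF.
rewrite (vnorm2_lt _ (ltW a0)) -scalemxAr sqnormZ r2 mulrC ltr_pdivrMr //.
Qed.

(** Countably many strict bounds replace the large one, so the infimum need not be shown to be
    attained. *)
Lemma smallest_sv_leP M (t : R) : (0 < n)%N -> 0 < t ->
  smallest_sv M <= t <->
  forall k : nat, exists x, sqnorm (M *m x) < (t + k.+1%:R^-1) ^+ 2 * sqnorm x.
Proof.
move=> n0 t0.
have p k : 0 < k.+1%:R^-1 :> R by rewrite invr_gt0 ltr0n.
split=> [h k|h].
  by apply/smallest_sv_ltP => //; [rewrite addr_gt0|rewrite (le_lt_trans h) // ltrDl].
rewrite leNgt; apply/negP => /ltr_add_invr[k].
apply/negP; rewrite -leNgt ltW //; apply/smallest_sv_ltP => //.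
by rewrite addr_gt0.
Qed.

(* The operator norm of [U adj(D + U)] is [|det (D + U)|] over the smallest
   singular value; the maximal entry controls it up to [n]. *)
Lemma det_le_entry D U (t : R) : (2 <= n)%N -> 0 < t -> U \is unitarymx ->
  smallest_sv (D + U) <= t ->
  exists i j, normc (det_add D U) <= 2 * t * n%:R ^+ 2 * normc (mul_adj D U i j).
Proof.
move=> n2 t0 uU ht.
have n0 : (0 < n)%N by exact: leq_trans n2.
have n0' : 0 < n%:R :> R by rewrite ltr0n.
apply: contrapT => H.
have {}H i j : 2 * t * n%:R ^+ 2 * normc (mul_adj D U i j) < normc (det_add D U).
  by rewrite ltNge; apply/negP => h; apply: H; exists i, j.
(* The factor 2 leaves room for a unit vector that only approaches the infimum. *)
have /inf_lt : smallest_sv (D + U) < 2 * t by lra.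
move=> /(_ (sphere_image_neq0 _ n0))[_ [x /= /vnorm2_eq1 x1 <-]].
set y := (D + U) *m x; rewrite vnorm2_lt ?mulr_ge0 ?(ltW t0) // => hy.
have yj j : normc (y j 0) <= 2 * t.
  rewrite -ler_sqr ?nnegrE ?normc_ge0 ?mulr_ge0 ?(ltW t0) //.
  apply: le_trans (ltW hy); rewrite /sqnorm (bigD1 j) //= lerDl.
  by apply: sumr_ge0 => k _; exact: sqr_ge0.
have d0 : 0 < normc (det_add D U).
  apply: le_lt_trans (H (Ordinal n0) (Ordinal n0)).
  by rewrite mulr_ge0 ?normc_ge0 // mulr_ge0 ?sqr_ge0 // mulr_ge0 // ltW.
have E : mul_adj D U *m y = det_add D U *: (U *m x).
  rewrite /mul_adj /y -mulmxA (mulmxA (\adj _)) mul_adj_mx mul_scalar_mx.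
  by rewrite scalemxAr.
(* By [E], entries of [mul_adj D U] that are all too small would make each coordinate of [U *m x] at
   most [1 / n]; its squared norm would be at most [1 / n < 1], although [U] preserves the norm 1 of
   [x]. *)
have Ux i : normc ((U *m x) i 0) <= n%:R^-1.
  rewrite -(ler_pM2l d0) -normcM.
  have -> : det_add D U * (U *m x) i 0 = (mul_adj D U *m y) i 0 by rewrite E [RHS]mxE.
  rewrite mxE; apply: le_trans (le_normc_sum _ _) _.
  have : \sum_(j < n) normc (mul_adj D U i j * y j 0) <=
      \sum_(j < n) normc (det_add D U) / n%:R ^+ 2.
    apply: ler_sum => j _; rewrite normcM ler_pdivlMr ?exprn_gt0 //.
    apply: le_trans (ltW (H i j)).
    rewrite [leRHS](_ : _ = normc (mul_adj D U i j) * (2 * t) * n%:R ^+ 2);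
      last by ring.
    apply: ler_wpM2r; first exact: sqr_ge0.
    by apply: ler_wpM2l; [exact: normc_ge0 | exact: yj].
  move=> /le_trans; apply; rewrite sumr_const card_ord -mulr_natl.
  by rewrite le_eqVlt; apply/orP; left; apply/eqP; field; rewrite gt_eqF.
have : sqnorm (U *m x) <= \sum_(i < n) (n%:R^-1) ^+ 2.
  apply: ler_sum => i _; rewrite ler_sqr ?nnegrE ?normc_ge0 ?invr_ge0 ?ler0n //.
have -> : \sum_(i < n) (n%:R^-1) ^+ 2 = n%:R^-1 :> R.
  by rewrite sumr_const card_ord -[LHS]mulr_natl expr2 mulVKf // gt_eqF.
rewrite sqnorm_unitary // x1; apply/negP; rewrite -ltNge invf_lt1 //.
by rewrite ltr1n.
Qed.

End SmallestSV.

(** * Rational approximation and measurability of the smallest singular value *)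

Section RationalApproximation.
Variable R : realType.

Lemma rat_approximation (r : R) :
  exists u : nat -> rat, ratr (u m) @[m --> \oo] --> r.
Proof.
have /choice[u hu] (m : nat) : exists q : rat, r <= ratr q <= r + m.+1%:R^-1.
  have /rat_in_itvoo[q] : r < r + m.+1%:R^-1 by rewrite ltrDl invr_gt0 ltr0n.
  by rewrite in_itv /= => /andP[/ltW h1 /ltW h2]; exists q; rewrite h1.
exists u; apply: (squeeze_cvgr (f := fun=> r) (h := fun m => r + m.+1%:R^-1)).
- by near=> m; exact: hu.
- exact: cvg_cst.
- rewrite -[X in _ --> X]addr0; apply: cvgD; first exact: cvg_cst.
  exact: cvg_harmonic.
Unshelve. all: by end_near. Qed.

Definition ccvg (u : nat -> R[i]) (l : R[i]) :=
  (complex.Re (u m) @[m --> \oo] --> complex.Re l) /\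
  (complex.Im (u m) @[m --> \oo] --> complex.Im l).

Lemma ccvg_cst l : ccvg (fun=> l) l.
Proof. by split; exact: cvg_cst. Qed.

Lemma ccvgD u v l k : ccvg u l -> ccvg v k -> ccvg (fun m => u m + v m) (l + k).
Proof.
move=> [ur ui] [vr vi]; split.
- by under eq_fun do rewrite raddfD /=; rewrite raddfD; exact: cvgD.
- by under eq_fun do rewrite raddfD /=; rewrite raddfD; exact: cvgD.
Qed.

Lemma ccvgM u v l k : ccvg u l -> ccvg v k -> ccvg (fun m => u m * v m) (l * k).
Proof.
move=> [ur ui] [vr vi]; split.
- have -> : (fun m => complex.Re (u m * v m)) = (fun m =>
      complex.Re (u m) * complex.Re (v m) - complex.Im (u m) * complex.Im (v m)).
    by apply/funext => m; case: (u m) (v m) => ? ? [].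
  have -> : complex.Re (l * k) =
      complex.Re l * complex.Re k - complex.Im l * complex.Im k.
    by case: (l) (k) => ? ? [].
  by apply: cvgB; exact: cvgM.
- have -> : (fun m => complex.Im (u m * v m)) = (fun m =>
      complex.Re (u m) * complex.Im (v m) + complex.Im (u m) * complex.Re (v m)).
    by apply/funext => m; case: (u m) (v m) => ? ? [].
  have -> : complex.Im (l * k) =
      complex.Re l * complex.Im k + complex.Im l * complex.Re k.
    by case: (l) (k) => ? ? [].
  by apply: cvgD; exact: cvgM.
Qed.

Lemma ccvg_sum (I : Type) (s : seq I) (u : I -> nat -> R[i]) (l : I -> R[i]) :
  (forall i, ccvg (u i) (l i)) ->
  ccvg (fun m => \sum_(i <- s) u i m) (\sum_(i <- s) l i).
Proof.
move=> ul; elim: s => [|i s ih].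
  by under eq_fun do rewrite big_nil; rewrite big_nil; exact: ccvg_cst.
by under eq_fun do rewrite big_cons; rewrite big_cons; exact: ccvgD.
Qed.

Lemma cvg_sqnorm n (M : 'M[R[i]]_n) (y : nat -> 'cV[R[i]]_n) (x : 'cV[R[i]]_n) :
  (forall i, ccvg (fun m => y m i 0) (x i 0)) ->
  sqnorm (M *m y m) @[m --> \oo] --> sqnorm (M *m x).
Proof.
move=> yx; rewrite /sqnorm.
have sum_cvg (s : seq 'I_n) (u : 'I_n -> nat -> R) (l : 'I_n -> R) :
    (forall i, u i m @[m --> \oo] --> l i) ->
    \sum_(i <- s) u i m @[m --> \oo] --> \sum_(i <- s) l i.
  move=> ul; elim: s => [|i s ih].
    by under eq_fun do rewrite big_nil; rewrite big_nil; exact: cvg_cst.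
  by under eq_fun do rewrite big_cons; rewrite big_cons; exact: cvgD.
apply: sum_cvg => i.
have [h1 h2] : ccvg (fun m => (M *m y m) i 0) ((M *m x) i 0).
  rewrite mxE; under eq_fun do rewrite mxE.
  by apply: ccvg_sum => j; apply: ccvgM => //; exact: ccvg_cst.
rewrite normc_sqr; under eq_fun do rewrite normc_sqr.
by apply: cvgD; rewrite expr2; under eq_fun do rewrite expr2; exact: cvgM.
Qed.

(** Indexing by finite functions into [rat * rat] gives a countable index type. *)
Definition rat_vector n (q : {ffun 'I_n -> rat * rat}) : 'cV[R[i]]_n :=
  \col_i (ratr (q i).1 +i* ratr (q i).2)%C.

(** Both sides are continuous in [x], so the strict inequality survives at a close enough rational
    vector. *)
Lemma sqnorm_lt_rat n (M : 'M[R[i]]_n) (a : R) (x : 'cV[R[i]]_n) :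
  sqnorm (M *m x) < a * sqnorm x ->
  exists q, sqnorm (M *m rat_vector q) < a * sqnorm (rat_vector q).
Proof.
move=> hx.
have /choice[ur hr] (i : 'I_n) := rat_approximation (complex.Re (x i 0)).
have /choice[ui hi] (i : 'I_n) := rat_approximation (complex.Im (x i 0)).
pose q m : {ffun 'I_n -> rat * rat} := [ffun i => (ur i m, ui i m)].
have qx i : ccvg (fun m => rat_vector (q m) i 0) (x i 0).
  split.
  - by under eq_fun do rewrite mxE ffunE /=; exact: hr.
  - by under eq_fun do rewrite mxE ffunE /=; exact: hi.
have c1 := cvg_sqnorm (M := M) qx.
have c2 : a * sqnorm (rat_vector (q m)) @[m --> \oo] --> a * sqnorm x.
  apply: cvgM; first exact: cvg_cst.
  (* The identity matrix gives the convergence of [sqnorm] itself. *)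
  have := cvg_sqnorm (M := 1%:M) qx; rewrite mul1mx.
  by under eq_fun do rewrite mul1mx.
have d0 : 0 < a * sqnorm x - sqnorm (M *m x) by rewrite subr_gt0.
have c3 : a * sqnorm (rat_vector (q m)) - sqnorm (M *m rat_vector (q m))
    @[m --> \oo] --> a * sqnorm x - sqnorm (M *m x) by exact: cvgB.
have near0 : \forall m \near \oo,
    0 < a * sqnorm (rat_vector (q m)) - sqnorm (M *m rat_vector (q m)).
  exact: (cvgr_gt _ c3).
by have [m] := filter_ex near0; rewrite subr_gt0 => h; exists (q m).
Qed.

Lemma measurable_smallest_sv_le n (D : 'M[R[i]]_n) (t : R) : (0 < n)%N -> 0 < t ->
  measurable [set U : cmxM R n | smallest_sv (D + U) <= t].
Proof.
move=> n0 t0.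
have -> : [set U : cmxM R n | smallest_sv (D + U) <= t] =
  \bigcap_k \bigcup_(q in [set: {ffun 'I_n -> rat * rat}])
    ~` [set U : cmxM R n | (t + k.+1%:R^-1) ^+ 2 * sqnorm (rat_vector q) <=
                           sqnorm ((D + U) *m rat_vector q)].
  apply/seteqP; split=> U.
  - move=> /(smallest_sv_leP _ n0 t0) h k _; have [x /sqnorm_lt_rat[q hq]] := h k.
    by exists q => //=; apply/negP; rewrite -ltNge.
  - move=> h; apply/(smallest_sv_leP _ n0 t0) => k; have [q _ /= hq] := h k I.
    by exists (rat_vector q); rewrite ltNge; apply/negP.
apply: bigcapT_measurable => k; apply: countable_bigcupT_measurable => // q.
apply: measurableC; apply: measurable_le_set; first exact: measurable_cst.
apply: measurable_sum => i; apply: measurable_normc_sqr.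
have : mx_cmeasurable (fun U : cmxM R n => (D + U) *m rat_vector q).
  apply: mx_cmeasurableM; last exact: mx_cmeasurable_cst.
  by apply: mx_cmeasurableD; [exact: mx_cmeasurable_cst|exact: mx_cmeasurable_id].
by apply.
Qed.

End RationalApproximation.

(** * The union bound, linear in [t] *)

Section LinearBound.
Variables (R : realType) (n : nat).
Local Open Scope ereal_scope.

Lemma smallest_sv_linear_bound (D : 'M[R[i]]_n) (P : probability (cmxM R n) R)
    (t : R) : (2 <= n)%N -> is_haar_unitary P -> (0 < t)%R ->
  P [set U : cmxM R n | (smallest_sv (D + U) <= t)%R] <= (64 * n%:R ^+ 4 * t)%:E.
Proof.
move=> n2 haarP t0; have n0 : (0 < n)%N by exact: leq_trans n2.
(* The constant of [det_le_entry]. Each of the [4 * n ^ 2] events contributes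
   [8 * kappa = 16 * t * n ^ 2], whence [64 * n ^ 4 * t]. *)
pose kappa : R := (2 * t * n%:R ^+ 2)%R.
have kappa0 : (0 <= kappa)%R by rewrite mulr_ge0 ?sqr_ge0 // mulr_ge0 // ltW.
pose S (p : 'I_4 * ('I_n * 'I_n)) : set (cmxM R n) :=
  near_singular D kappa (polar_vector (unit4 R p.1) p.2.1 p.2.2).
pose Z : set (cmxM R n) := [set U | (det_add D U = 0)%R].
have mS p : measurable (S p).
  by apply: measurable_near_singular => //; exact: mx_cmeasurable_id.
have mZ : measurable Z.
  apply: measurable_eq_set; last exact: cmeasurable_cst.
  by apply: cmeasurable_det_shift; exact: mx_cmeasurable_id.
have mUn := @measurable_unitary R n.
have mB : measurable (\big[setU/set0]_p S p) by exact: bigsetU_measurable.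
have mC := measurableC mUn.
have cover : [set U : cmxM R n | (smallest_sv (D + U) <= t)%R] `<=`
    ~` [set U : cmxM R n | U \is unitarymx] `|` (Z `|` \big[setU/set0]_p S p).
  move=> U /= hU; have [uU|nU] := pselect (U \is unitarymx); last by left.
  right; have [Z0|nZ] := eqVneq (det_add D U) 0%R; [by left|right].
  have [i [j hij]] := det_le_entry n2 t0 uU hU.
  have [k hk] := polarization i j (mul_adj D U).
  rewrite -bigcup_seq /=; exists (k, (i, j)); first exact: mem_index_enum.
  by split => //=; apply: le_trans hij _; apply: ler_wpM2l.
(* The error collects [n / N] from singular matrices and [1 / N] from each of the [4 * n ^ 2]
   events. *)
have bound N : (0 < N)%N ->
    P [set U : cmxM R n | (smallest_sv (D + U) <= t)%R] <=
    (64 * n%:R ^+ 4 * t + (n%:R + 4 * n%:R ^+ 2) / N%:R)%:E.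
  move=> N0.
  apply: (@le_trans _ _ (P (~` [set U : cmxM R n | U \is unitarymx]) +
      (P Z + P (\big[setU/set0]_p S p)))).
    apply: (@le_trans _ _ (P (~` [set U : cmxM R n | U \is unitarymx] `|`
        (Z `|` \big[setU/set0]_p S p)))).
      apply: le_measure => //; rewrite inE.
        exact: measurable_smallest_sv_le.
      by apply: measurableU => //; exact: measurableU.
    apply: le_trans (measureU2 _ _ _) _ => //; first exact: measurableU.
    by apply: leeD2l; exact: measureU2.
  have -> : P (~` [set U : cmxM R n | U \is unitarymx]) = 0.
    by rewrite probability_setC // haarP.1 subee.
  rewrite add0e.
  have PS : P (\big[setU/set0]_p S p) <=
      \sum_(p : 'I_4 * ('I_n * 'I_n)) (8 * kappa + N%:R^-1)%:E.
    apply: le_trans (probability_bigsetU_le _ _ mS) _; apply: lee_sum => p _.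
    apply: P_near_singular => //; apply: norm_polar_vector; exact: norm_unit4.
  apply: le_trans (leeD (P_singular D haarP N0) PS) _.
  rewrite sumEFin -EFinD lee_fin sumr_const !card_prod !card_ord.
  rewrite -(mulr_natl (8 * kappa + N%:R^-1)%R) !natrM /kappa.
  rewrite le_eqVlt; apply/orP; left; apply/eqP.
  by ring.
(* The probability does not depend on [N], so taking [N > y / e] brings the error below any [e]. *)
apply/lee_addgt0Pr => e e0.
pose y : R := (n%:R + 4 * n%:R ^+ 2)%R.
have y0 : (0 <= y)%R by rewrite addr_ge0 // mulr_ge0 // sqr_ge0.
have [N hN] : exists N : nat, (y / e < N%:R)%R.
  by exists (Num.truncn (y / e)).+1; exact: truncnS_gt.
have N0 : (0 < N%:R :> R)%R by apply: le_lt_trans hN; rewrite divr_ge0 // ltW.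
apply: le_trans (bound N _) _; first by rewrite -(ltr0n R).
rewrite -EFinD lee_fin lerD2l ler_pdivrMr //.
by have := ltW hN; rewrite ler_pdivrMr // [(e * _)%R]mulrC.
Qed.

End LinearBound.

Theorem theorem9p1 (R : realType) :
  exists c C : R, 0 < c /\ 0 < C /\
  forall (n : nat), (2 <= n)%N ->
  forall (D : 'M[R[i]]_n) (P : probability (cmxM R n) R),
  is_haar_unitary P ->
  forall t : R, 0 < t ->
    (P [set U : cmxM R n | (smallest_sv (D + U) <= t)%R]
       <= ((t `^ c) * (n%:R `^ C))%:E)%E.
Proof.
(* Since [n >= 2], the constant [64 = 2 ^ 6] is at most [n ^ 6]; together with [n ^ 4] this gives
   the exponent 10. *)
exists 1, 10%:R; split => //; split; first by rewrite ltr0n.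
move=> n n2 D P haarP t t0.
apply: le_trans (smallest_sv_linear_bound D n2 haarP t0) _.
rewrite lee_fin (powRr1 (ltW t0)) powR_mulrn //.
rewrite [leLHS]mulrC; apply: ler_wpM2l; first exact: ltW.
rewrite (exprD n%:R 6 4); apply: ler_wpM2r; first exact: exprn_ge0.
by rewrite -natrX ler_nat (@leq_exp2r 2 n 6).
Qed.
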